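(* Let $X$ and $Y$ be real Hilbert spaces and $A\in\mathcal L(X,Y)$. Let $P\subset X$ be a cone (not necessarily convex or closed) and let $K\subset X$ be a bounded set containing $0$ with $\operatorname{cone}(K)=P$. Let $K_r=\overline{\operatorname{conv}}(K)$ and $P_r=\operatorname{cone}(K_r)$. Assume that $A^*y\in\operatorname{sing}(K_r)^c\cup P_r^\circ$ for all $y\in Y$, and that $\operatorname{ext}(K_r)\subset K$. Then $\overline{A(P_r)}=\overline{A(P)}$.
   Context: $\mathcal L(X,Y)$ is the space of bounded linear operators; $A^*\in\mathcal L(Y,X)$ is the Hilbert adjoint. For $C\subset X$ containing $0$, $\operatorname{cone}(C)=\{\lambda c:\lambda\ge0,\ c\in C\}$. $\overline{\operatorname{conv}}(K)$ is the closed convex hull. $\operatorname{sing}(K_r)$ is the set of $z\in X$ such that the set of maximisers of $v\mapsto\langle z,v\rangle_X$ over $K_r$ is not a singleton, and $\operatorname{sing}(K_r)^c$ its complement in $X$. $P_r^\circ=\{x\in X:\langle x,v\rangle_X\le0\ \forall v\in P_r\}$ is the polar cone. $\operatorname{ext}(K_r)$ is the set of extreme points of $K_r$. *)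

(* Defs.v *)
From HB Require Import structures.
From mathcomp Require Import all_boot all_order all_algebra.
From mathcomp Require Import all_classical all_reals all_analysis.
From mathcomp Require Import ring lra.

Set Implicit Arguments.
Unset Strict Implicit.
Unset Printing Implicit Defensive.

Import Order.TTheory GRing.Theory Num.Theory.
Import numFieldNormedType.Exports.

Local Open Scope classical_set_scope.
Local Open Scope ring_scope.

HB.mixin Record CompleteNormedModule_isHilbert (R : realType) (X : Type)
    of CompleteNormedModule R X := {
  inner : {dot X for idfun};
  inner_norm : forall x : X, inner x x = `|x| ^+ 2
}.

#[short(type="hilbertType")]
HB.structure Definition Hilbert (R : realType) :=
  {X of CompleteNormedModule R X & CompleteNormedModule_isHilbert R X}.

Section InnerTheory.
Context {R : realType} {X : hilbertType R}.
Implicit Types x y z : X.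

Lemma innerC x y : inner x y = inner y x.
Proof. by rewrite hermC expr0 mul1r. Qed.

Lemma innerDl x y z : inner (x + y) z = inner x z + inner y z.
Proof. exact: linearDl. Qed.

Lemma innerDr x y z : inner x (y + z) = inner x y + inner x z.
Proof. exact: linearDr. Qed.

Lemma innerZl (a : R) x y : inner (a *: x) y = a * inner x y.
Proof. exact: linearZl_LR. Qed.

Lemma innerZr (a : R) x y : inner x (a *: y) = a * inner x y.
Proof. exact: linearZr_LR. Qed.

Lemma innerNl x y : inner (- x) y = - inner x y.
Proof. by rewrite -scaleN1r innerZl mulN1r. Qed.

Lemma innerNr x y : inner x (- y) = - inner x y.
Proof. by rewrite -scaleN1r innerZr mulN1r. Qed.

Lemma normDsq x y : `|x + y| ^+ 2 = `|x| ^+ 2 + 2 * inner x y + `|y| ^+ 2.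
Proof. by rewrite -!inner_norm !(innerDl, innerDr) (innerC y x); ring. Qed.

Lemma inner_inj x y : (forall u, inner u x = inner u y) -> x = y.
Proof.
move=> h; apply/eqP; rewrite -subr_eq0 -normr_eq0 -sqrf_eq0 -inner_norm.
by rewrite innerDr innerNr h subrr.
Qed.

Lemma norm_inner_le x y : `|inner x y| <= `|x| * `|y|.
Proof.
have [->|y0] := eqVneq y 0.
  by rewrite -(scale0r (0 : X)) innerZr mul0r normr0 mulr_ge0.
have Y0 : 0 < `|y| ^+ 2 by rewrite exprn_gt0// normr_gt0.
rewrite -(@ler_pXn2r _ 2) ?nnegrE ?mulr_ge0// exprMn real_normK ?num_real//.
have := sqr_ge0 (Num.norm ((`|y| ^+ 2) *: x - inner x y *: y)).
rewrite normDsq normrN innerNr innerZl innerZr !normrZ !exprMn.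
rewrite !real_normK ?num_real//.
move: (`|y| ^+ 2) (`|x| ^+ 2) Y0 => Y V Y0; rewrite -subr_ge0.
have -> : Y ^+ 2 * V + 2 * - (Y * (inner x y * inner x y)) + inner x y ^+ 2 * Y
  = Y * (V * Y - inner x y ^+ 2) by ring.
by rewrite pmulr_rge0.
Qed.

Lemma riesz (f : {linear X -> R^o}) : continuous f ->
  exists x, forall u, inner u x = f u.
Proof.
move=> fc.
pose J u : R := `|u| ^+ 2 - 2 * f u.
have fD u v : f (u + v) = f u + f v :> R by exact: linearD.
have fZ (a : R) u : f (a *: u) = a * f u by exact: linearZ.
have JD u v : J (u + v) = J u + (2 * inner u v - 2 * f v) + `|v| ^+ 2.
  by rewrite /J normDsq fD; ring.
have JZ (a : R) u : J (a *: u) = a ^+ 2 * `|u| ^+ 2 - 2 * (a * f u).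
  by rewrite /J normrZ exprMn real_normK ?num_real// fZ.
have /linear_boundedP/pinfty_ex_gt0[M M0 fM] : bounded_near f (nbhs (0 : X)).
  exact/linear_bounded_continuous.
have Jge u : - M ^+ 2 <= J u.
  rewrite /J; have := fM u; rewrite ler_norml => /andP[_ fu].
  by have := sqr_ge0 (`|u| - M); nra.
have hasJ : has_inf (range J).
  split; first by exists (J 0); exists 0.
  by exists (- M ^+ 2) => _ [u _ <-].
pose m := inf (range J).
have mJ u : m <= J u by apply: ge_inf; [exact: hasJ.2|exists u].
have /choice[a aJ] : forall n, exists u, J u < m + n.+1%:R^-1.
  move=> n; have n0 : 0 < n.+1%:R^-1 :> R by rewrite invr_gt0.
  by have [_ [u _ <-] ?] := inf_adherent n0 hasJ; exists u.
have apart u v : `|u - v| ^+ 2 <= 2 * (J u - m) + 2 * (J v - m).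
  have := mJ (2^-1 *: (u + v)); rewrite JZ normDsq fD.
  rewrite normDsq normrN innerNr /J; lra.
have a_cauchy : cauchy (a @ \oo).
  apply/cauchyP => e e0 /=.
  have e40 : 0 < e ^+ 2 / 4 by rewrite divr_gt0// exprn_gt0.
  have [N _ HN] := near_infty_natSinv_lt (PosNum e40).
  exists (a N); exists N => // n /= Nn.
  rewrite -ball_normE /=.
  have n1 : n.+1%:R^-1 < e ^+ 2 / 4 := HN _ Nn.
  have N1 : N.+1%:R^-1 < e ^+ 2 / 4 := HN _ (leqnn N).
  have := apart (a N) (a n); have := aJ n; have := aJ N => h1 h2 h3.
  rewrite -(@ltr_pXn2r _ 2) ?nnegrE ?normr_ge0 ?(ltW e0)//.
  apply: (le_lt_trans h3); move: h1 h2 n1 N1; move: (e ^+ 2) (J _) (J _) (N.+1%:R^-1)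
    (n.+1%:R^-1) => *; lra.
have /cauchy_cvgP a_cvg := a_cauchy.
pose x := lim (a @ \oo).
have ax : a @ \oo --> x by [].
have Jx : J x = m.
  have c1 : (J \o a) @ \oo --> J x.
    apply: cvgB; last by apply: cvgM; [exact: cvg_cst|apply: cvg_comp ax _; exact: fc].
    rewrite expr2; under eq_fun do rewrite expr2.
    by apply: cvgM; exact: cvg_norm ax.
  have c2 : (J \o a) @ \oo --> m.
    apply: (@squeeze_cvgr _ _ _ _ (cst m) (fun n => m + n.+1%:R^-1)).
    - by apply: nearW => n /=; rewrite mJ ltW.
    - exact: cvg_cst.
    - rewrite -[X in _ --> X]addr0; apply: cvgD; first exact: cvg_cst.
      exact: cvg_harmonic.
  exact: (cvg_unique _ c1 c2).
exists x => u.
pose d := inner u x - f u.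
have key (t : R) : 0 <= 2 * t * d + t ^+ 2 * `|u| ^+ 2.
  have := mJ (x + t *: u); rewrite JD Jx innerZr fZ (innerC x u).
  rewrite normrZ exprMn real_normK ?num_real// /d; lra.
suff : d = 0 by move/eqP; rewrite subr_eq0 => /eqP.
have [u0|u0] := eqVneq `|u| 0.
  by have := key (- d); rewrite u0; nra.
have U0 : 0 < `|u| ^+ 2 by rewrite exprn_gt0// lt_neqAle eq_sym u0 normr_ge0.
have := key (- d / `|u| ^+ 2).
have -> : 2 * (- d / `|u| ^+ 2) * d + (- d / `|u| ^+ 2) ^+ 2 * `|u| ^+ 2
   = - (d ^+ 2 / `|u| ^+ 2) by field.
rewrite oppr_ge0 => h.
have : d ^+ 2 <= 0 by rewrite -(@pmulr_lle0 _ (`|u| ^+ 2)^-1) ?invr_gt0// mulrC.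
by rewrite exprn_even_le0//= => /eqP.
Qed.

End InnerTheory.

(* [adjointE] and [inner_inj]: for bounded [A] this is the unique [x] with
   <u, x> = <A u, y> for all [u]; the default [0] is then never used. *)
Definition adjoint {R : realType} {X Y : hilbertType R} (A : X -> Y) (y : Y) : X :=
  xget 0 [set x : X | forall u, inner u x = inner (A u) y].

Lemma adjointE {R : realType} {X Y : hilbertType R} (A : {linear X -> Y}) :
  bounded_near A (nbhs 0) ->
  forall u y, inner u (adjoint A y) = inner (A u) y.
Proof.
move=> Ab u y; rewrite /adjoint; case: xgetP => [x _ ->//|nx].
have flin : linear (fun v => inner (A v) y : R^o).
  by move=> a v w; rewrite linearP innerDl innerZl.
pose fM := GRing.isLinear.Build R X R^o *:%R _ flin.
pose f : {linear X -> R^o} := HB.pack (fun v => inner (A v) y : R^o) fM.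
have fc : continuous f.
  apply: bounded_linear_continuous; apply/linear_boundedP.
  have /linear_boundedP/pinfty_ex_gt0[M M0 AM] := Ab.
  exists (M * `|y|); split=> [|r /ltW Mr v]; first exact: num_real.
  apply: le_trans (norm_inner_le (A v) y) _.
  rewrite (@le_trans _ _ (M * `|v| * `|y|))//; first by rewrite ler_wpM2r.
  by rewrite mulrAC ler_wpM2r.
by have [x fx] := riesz fc; have := nx x fx.
Qed.

Definition cone {R : realType} {X : hilbertType R} (C : set X) : set X :=
  [set l *: c | l in [set l : R | 0 <= l] & c in C].

Definition is_cone {R : realType} {X : hilbertType R} (P : set X) :=
  forall (l : R) x, 0 <= l -> P x -> P (l *: x).

Definition polar_cone {R : realType} {X : hilbertType R} (P : set X) : set X :=
  [set x | forall v, P v -> inner x v <= 0].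

Definition conv_hull {R : realType} {X : hilbertType R} (K : set X) : set X :=
  smallest (@convex_set R X) K.

Definition closed_conv_hull {R : realType} {X : hilbertType R} (K : set X) :
  set X := closure (conv_hull K).

Definition maximisers {R : realType} {X : hilbertType R} (C : set X) (z : X) :
  set X := [set v | C v /\ forall w, C w -> inner z w <= inner z v].

(* An empty set of maximisers is not a singleton. *)
Definition sing {R : realType} {X : hilbertType R} (C : set X) : set X :=
  [set z | ~ exists v, maximisers C z = [set v]].

Definition extreme_points {R : realType} {X : hilbertType R} (C : set X) :
  set X :=
  [set x | C x /\ forall a b (t : R), C a -> C b -> 0 < t < 1 ->
     x = t *: a + (1 - t) *: b -> a = x /\ b = x].

(* Main.v *)
Require Import Defs.
From HB Require Import structures.
From mathcomp Require Import all_boot all_order all_algebra.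
From mathcomp Require Import all_classical all_reals all_analysis.
From mathcomp Require Import ring lra.

Set Implicit Arguments.
Unset Strict Implicit.
Unset Printing Implicit Defensive.

Import Order.TTheory GRing.Theory Num.Theory.
Import numFieldNormedType.Exports.

Local Open Scope classical_set_scope.
Local Open Scope ring_scope.

(** The inclusion from right to left holds because [K] lies in [Kr].  For the
    other one, a point [y0] of [A @` Pr] must be approximated by points of
    [A @` P].

    Let [s] be the infimum of the [l >= 0] such that [y0] lies in
    [l *: A @` Kr], and let [t < s] be close to [s].  If [t <= 0] then [s] is
    close to [0], so [y0] is small because [Kr] is bounded, and [0] approximates
    it.  If [t > 0], let [v] minimise the distance from [A v] to [y0 / t] over
    the bounded closed convex set [Kr] (a minimiser exists by a weak
    compactness argument, [nested_convex_nonempty]).  Then [t *: A v] is close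
    to [y0], since [y0] lies in [l *: A @` Kr] for some [l] close to [t].  The
    optimality condition [nearest_image_variational] says that [v] maximises
    [<z, _>] over [Kr] for [z = A^* (y0 / t - A v)].  Two cases remain.
    - If [z] is not in [sing Kr], the maximiser [v] is unique, hence extreme
      ([unique_maximiser_extreme]), hence in [K], and [t *: v] is in [P].
    - If [z] is in the polar cone of [Pr], then [<z, _>] is nonpositive on
      [Kr] and nonnegative at [v], which forces [A v = y0 / t]: then [y0]
      lies in [t *: A @` Kr], against [t < s].  Staying strictly below
      the infimum is what excludes this degenerate case. *)

(** * Convex sets and closures in Hilbert spaces *)

Section HilbertConvex.
Context {R : realType} {X : hilbertType R}.
Implicit Types (C K : set X) (x z : X).

Lemma closure_normP C x :
  closure C x <-> forall e : R, 0 < e -> exists2 c, C c & `|x - c| < e.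
Proof.
split=> [Cx e e0|h B /nbhs_ballP[e /= e0 xeB]].
  have [c [Cc]] := Cx _ (nbhsx_ballx x e e0).
  by rewrite -ball_normE /= => xc; exists c.
have [c Cc xc] := h e e0; exists c; split=> //.
by apply: xeB; rewrite -ball_normE.
Qed.

(** Convexity as a condition on real weights, free of the interval type in
    which [convex_set] takes its coefficients. *)
Definition weight_convex C := forall a b (t : R), C a -> C b ->
  0 <= t -> t <= 1 -> C (t *: a + (1 - t) *: b).

Lemma convex_set_weight C : convex_set C <-> weight_convex C.
Proof.
split=> [cC a b t Ca Cb t0 t1|cC a b l].
  by have := cC a b (Itv01 t0 t1); rewrite !inE; apply.
by rewrite !inE => Ca Cb; apply: cC.
Qed.

Lemma norm_conv_le (V : normedModType R) (a b : V) (t : R) :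
  0 <= t -> t <= 1 -> `|t *: a + (1 - t) *: b| <= Num.max `|a| `|b|.
Proof.
move=> t0 t1; apply: (le_trans (ler_normD _ _)).
rewrite !normrZ !ger0_norm ?subr_ge0//.
have : `|a| <= Num.max `|a| `|b| by rewrite le_max lexx.
have : `|b| <= Num.max `|a| `|b| by rewrite le_max lexx orbT.
nra.
Qed.

Lemma weight_convex_closure C : weight_convex C -> weight_convex (closure C).
Proof.
move=> cC a b t /closure_normP ha /closure_normP hb t0 t1.
apply/closure_normP => e e0.
have [a' Ca' aa'] := ha e e0; have [b' Cb' bb'] := hb e e0.
exists (t *: a' + (1 - t) *: b'); first exact: cC.
have -> : t *: a + (1 - t) *: b - (t *: a' + (1 - t) *: b') =
    t *: (a - a') + (1 - t) *: (b - b').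
  by rewrite opprD addrACA -!scalerBr.
by apply: le_lt_trans (norm_conv_le _ _ t0 t1) _; rewrite gt_max aa' bb'.
Qed.

Lemma weight_convex_conv_hull K : weight_convex (conv_hull K).
Proof.
move=> a b t ha hb t0 t1 C [/[dup] /convex_set_weight cC ? KC].
by apply: cC => //; [apply: ha|apply: hb].
Qed.

Lemma sub_closed_conv_hull K : K `<=` closed_conv_hull K.
Proof.
by apply: subset_trans; [exact: (@sub_gen_smallest _ (@convex_set R X) K)|
  exact: subset_closure].
Qed.

Lemma closed_conv_hull_bounded K : bounded_set K ->
  exists2 M : R, 0 < M & forall v, closed_conv_hull K v -> `|v| <= M.
Proof.
move=> /pinfty_ex_gt0[M M0 KM]; exists M => // v.
rewrite /closed_conv_hull closureE => /(_ [set x | `|x| <= M]); apply; split.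
  exact: (preimage_closed (fun x _ => @norm_continuous _ X x) (@closed_le R M)).
apply: smallest_sub => [|x Kx]; last exact: KM.
apply/convex_set_weight => a b t /= aM bM t0 t1.
by apply: le_trans (norm_conv_le _ _ t0 t1) _; rewrite ge_max aM bM.
Qed.

(** The countable form of the weak compactness of bounded closed convex sets.
    Near-minimisers of the norm on the successive sets form a Cauchy sequence:
    by the parallelogram identity, two points of a convex set whose squared
    norms are close to the infimum are close to each other. *)
Lemma nested_convex_nonempty (C : nat -> set X) (M : R) :
  (forall n, C n !=set0) ->
  (forall n, closed (C n)) ->
  (forall n, weight_convex (C n)) ->
  (forall n m, (n <= m)%N -> C m `<=` C n) ->
  (forall x, C 0%N x -> `|x| <= M) ->
  exists x, forall n, C n x.
Proof.
move=> C0 Ccl Ccv Cdec CM.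
pose S n : set R := [set `|x| ^+ 2 | x in C n].
have hasS n : has_inf (S n).
  split; first by have [x Cx] := C0 n; exists (`|x| ^+ 2), x.
  by exists 0 => _ [x _ <-]; rewrite exprn_ge0.
pose r n := inf (S n).
have rle n x : C n x -> r n <= `|x| ^+ 2.
  by move=> Cx; apply: ge_inf; [exact: (hasS n).2|exists x].
have /choice[a ha] : forall n, exists x, C n x /\ `|x| ^+ 2 < r n + n.+1%:R^-1.
  move=> n; have n0 : 0 < n.+1%:R^-1 :> R by rewrite invr_gt0.
  by have [_ [x Cx <-] ?] := inf_adherent n0 (hasS n); exists x.
have rdec n m : (n <= m)%N -> r n <= r m.
  move=> nm; apply: lb_le_inf; first exact: (hasS m).1.
  by move=> _ [x Cx <-]; apply: rle; exact: Cdec Cx.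
have hasr : has_sup (range r).
  split; first by exists (r 0%N), 0%N.
  exists (M ^+ 2) => _ [n _ <-]; have [x Cx] := C0 n.
  apply: (le_trans (rle _ _ Cx)).
  have xM : `|x| <= M by apply: CM; exact: Cdec Cx.
  by rewrite ler_pXn2r ?nnegrE// (le_trans _ xM).
pose s := sup (range r).
have rs n : r n <= s by apply: ub_le_sup; [exact: hasr.2|exists n].
have apart n k : (n <= k)%N ->
    `|a n - a k| ^+ 2 <= 2 * (s - r n) + 2 * n.+1%:R^-1 + 2 * k.+1%:R^-1.
  move=> nk; have [Cn an] := ha n; have [/(Cdec _ _ nk) Ck ak] := ha k.
  have half0 : 0 <= 2^-1 :> R by rewrite invr_ge0.
  have half1 : 2^-1 <= 1 :> R by rewrite invf_le1// ler1n.
  have /rle := Ccv n _ _ 2^-1 Cn Ck half0 half1.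
  rewrite (_ : 1 - 2^-1 = 2^-1 :> R); last by field.
  rewrite -scalerDr normrZ ger0_norm// exprMn !normDsq normrN innerNr.
  have := rs k; rewrite (_ : 2^-1 ^+ 2 = 4^-1 :> R); last by field.
  move: an ak; move: (_ ^+ 2) (_ ^+ 2) (n.+1%:R^-1) (k.+1%:R^-1) => *; lra.
have a_cauchy : cauchy (a @ \oo).
  apply/cauchyP => e e0 /=.
  have e80 : 0 < e ^+ 2 / 8 by rewrite divr_gt0// exprn_gt0.
  have [_ [N1 _ <-] h1] := sup_adherent e80 hasr.
  have [N2 _ h2] := near_infty_natSinv_lt (PosNum e80).
  pose N := maxn N1 N2.
  exists (a N); exists N => // n /= Nn; rewrite -ball_normE /=.
  rewrite -(@ltr_pXn2r _ 2) ?nnegrE ?(ltW e0)//.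
  apply: (le_lt_trans (apart N n Nn)).
  have i1 : N.+1%:R^-1 < e ^+ 2 / 8 := h2 N (leq_maxr _ _).
  have i2 : n.+1%:R^-1 < e ^+ 2 / 8 := h2 n (leq_trans (leq_maxr _ _) Nn).
  have i3 := rdec _ _ (leq_maxl N1 N2 : (N1 <= N)%N).
  move: (e80) h1 i1 i2 i3; rewrite -/s.
  move: (N.+1%:R^-1) (n.+1%:R^-1) (e ^+ 2) => *; lra.
have /cauchy_cvgP a_cvg := a_cauchy.
exists (lim (a @ \oo)) => n.
apply: (closed_cvg _ (Ccl n) _ _ a_cvg).
by exists n => // k /= nk; exact: Cdec nk _ (ha k).1.
Qed.

Lemma unique_maximiser_extreme C z v :
  maximisers C z = [set v] -> extreme_points C v.
Proof.
move=> mE; have [Cv vmax] : maximisers C z v by rewrite mE.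
split=> // a b t Ca Cb /andP[t0 t1] vE.
have := vmax _ Ca; have := vmax _ Cb.
have zv : inner z v = t * inner z a + (1 - t) * inner z b.
  by rewrite {1}vE innerDr !innerZr.
move=> bv av.
have za : inner z a = inner z v by nra.
have zb : inner z b = inner z v by nra.
by split; rewrite -[_ = v]/([set v] _) -mE; split => // w Cw;
  rewrite ?za ?zb; exact: vmax.
Qed.

End HilbertConvex.

(** * Nearest points in the image of a convex set *)

Section NearestImage.
Context {R : realType} {X Y : hilbertType R}.
Variables (A : {linear X -> Y}) (C : set X) (y : Y).

Lemma nearest_image_exists (M : R) :
  continuous A -> C !=set0 -> closed C -> weight_convex C ->
  (forall x, C x -> `|x| <= M) ->
  exists2 v, C v & forall u, C u -> `|A v - y| <= `|A u - y|.
Proof.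
move=> Ac [c Cc] Ccl Ccv CM.
pose S : set R := [set `|A x - y| | x in C].
have hasS : has_inf S.
  split; first by exists (`|A c - y|), c.
  by exists 0 => _ [x _ <-].
pose m := inf S.
have [n|n|n|n k nk|x [/CM]//|v hv] := @nested_convex_nonempty R X
  (fun n => [set x | C x /\ `|A x - y| <= m + n.+1%:R^-1]) M.
- have n0 : 0 < n.+1%:R^-1 :> R by rewrite invr_gt0.
  by have [_ [x Cx <-] /ltW ?] := inf_adherent n0 hasS; exists x.
- apply: closedI => //.
  apply: (@preimage_closed _ _ (fun x => `|A x - y|) _ _ (@closed_le R _)) => x _.
  by apply: cvg_norm; apply: cvgB; [exact: Ac|exact: cvg_cst].
- move=> a b t [Ca am] [Cb bm] t0 t1; split; first exact: Ccv.
  have -> : A (t *: a + (1 - t) *: b) - y =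
      t *: (A a - y) + (1 - t) *: (A b - y).
    rewrite linearD !linearZ /= !scalerBr addrACA -opprD -scalerDl.
    by rewrite (addrC t) subrK scale1r.
  by apply: le_trans (norm_conv_le _ _ t0 t1) _; rewrite ge_max am bm.
- move=> x [Cx xk]; split=> //; apply: (le_trans xk).
  by rewrite lerD2l lef_pV2 ?posrE// ler_nat.
exists v => [|u Cu]; first exact: (hv 0%N).1.
apply: (@le_trans _ _ m); last by apply: ge_inf; [exact: hasS.2|exists u].
apply/ler_addgt0Pr => e e0.
have [N _ hN] := near_infty_natSinv_lt (PosNum e0).
apply: (le_trans (hv N).2); rewrite lerD2l.
exact/ltW/(hN N (leqnn N)).
Qed.

(** Moving from [v] a fraction [t] of the way to [u] changes the squared
    distance by [- 2 t <y - A v, A (u - v)> + O(t ^ 2)]; this cannot be negative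
    for small [t]. *)
Lemma nearest_image_variational v u :
  weight_convex C -> C v -> C u ->
  (forall w, C w -> `|A v - y| <= `|A w - y|) ->
  inner (A u) (y - A v) <= inner (A v) (y - A v).
Proof.
move=> Ccv Cv Cu vmin; rewrite -subr_ge0 -oppr_le0 opprB -innerNl -innerDl.
set h := A u - A v; set d := inner h (y - A v).
have key (t : R) : 0 <= t -> t <= 1 -> 2 * t * d <= t ^+ 2 * `|h| ^+ 2.
  move=> t0 t1; have := vmin _ (Ccv _ _ _ Cu Cv t0 t1).
  have -> : A (t *: u + (1 - t) *: v) - y = (A v - y) + t *: h.
    rewrite linearD !linearZ /= /h scalerBr scalerBl scale1r.
    by rewrite [in LHS]addrCA addrAC.
  rewrite -(@ler_pXn2r _ 2) ?nnegrE// (normDsq _ (t *: h)) innerZr normrZ exprMn.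
  rewrite real_normK ?num_real//.
  have -> : inner (A v - y) h = - d by rewrite /d -innerNr opprB innerC.
  lra.
rewrite leNgt; apply/negP => d0.
pose q := `|h| ^+ 2.
have q0 : 0 <= q by rewrite exprn_ge0.
(* [t = d / (d + q)] lies in the unit interval and satisfies [t * q < 2 * d]. *)
have dq0 : 0 < d + q by lra.
have t0 : 0 < d / (d + q) by rewrite divr_gt0.
have t1 : d / (d + q) <= 1 by rewrite ler_pdivrMr// mul1r lerDl.
have := key _ (ltW t0) t1; rewrite -/q.
have tE : d / (d + q) * (d + q) = d by rewrite divfK// gt_eqF.
move: (d / (d + q)) t0 t1 tE => t t0 t1 tE.
rewrite expr2 -mulrA -mulrA mulrCA ler_pM2l//.
by nra.
Qed.

End NearestImage.

(** * Approximating the relaxed image *)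

Theorem corollary1p1 (R : realType) (X Y : hilbertType R)
    (A : {linear X -> Y}) (P K : set X) :
  bounded_near A (nbhs 0) ->
  is_cone P ->
  bounded_set K ->
  K 0 ->
  cone K = P ->
  let Kr := closed_conv_hull K in
  let Pr := cone Kr in
  (forall y : Y, (~` sing Kr `|` polar_cone Pr) (adjoint A y)) ->
  extreme_points Kr `<=` K ->
  closure (A @` Pr) = closure (A @` P).
Proof.
move=> Ab _ Kb K0 <- Kr Pr hsing hext; rewrite eqEsubset; split; last first.
  apply: closureS => _ [_ [l l0 [c Kc <-]] <-].
  exists (l *: c) => //; exists l => //; exists c => //.
  exact: sub_closed_conv_hull.
rewrite [X in _ `<=` X](closure_id _).1; last exact: closed_closure.
apply: closureS => _ [_ [l0 l00 [v0 Kv0 <-]] <-].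
have Ac : continuous A.
  by apply: bounded_linear_continuous.
have [M M0 KM] := closed_conv_hull_bounded Kb.
have [B B0 AB] : exists2 B : R, 0 < B & forall v, Kr v -> `|A v| <= B.
  have /linear_boundedP/pinfty_ex_gt0[N N0 AN] := Ab.
  exists (N * M); first exact: mulr_gt0.
  by move=> v /KM vM; apply: (le_trans (AN v)); rewrite ler_pM2l.
have Kr0 : Kr 0 by exact: sub_closed_conv_hull.
have Krcv : weight_convex Kr.
  apply: weight_convex_closure; exact: weight_convex_conv_hull.
set y0 := A (l0 *: v0).
pose S := [set l : R | 0 <= l /\ exists2 v, Kr v & y0 = l *: A v].
have hasS : has_inf S.
  split; last by exists 0 => l [].
  by exists l0; split=> //; exists v0 => //; rewrite /y0 linearZ.
apply/closure_normP => e e0.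
(* The weights [t] and [l] below differ by less than [2 * d], and [B] bounds
   [A] on [Kr], so replacing [l] by [t] moves the image by less than [e]. *)
pose d := e / (2 * B).
have d0 : 0 < d by rewrite divr_gt0// mulr_gt0.
have dB : 2 * d * B = e by rewrite /d; field; rewrite gt_eqF.
have [l [l_ge0 [v' Kv' y0E]] ls] := inf_adherent d0 hasS.
pose t := inf S - d.
have lt2d : l - t < 2 * d by rewrite /t; lra.
have near_v' : `|l - t| * `|A v'| < e -> `|t *: A v' - y0| < e.
  by rewrite y0E -scalerBl normrZ distrC.
have tl : t < l.
  have : inf S <= l by apply: ge_inf; [exact: hasS.2|split=> //; exists v'].
  by rewrite /t; lra.
have close : `|l - t| * `|A v'| < e.
  rewrite gtr0_norm ?subr_gt0//; have := AB _ Kv'.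
  rewrite -dB => h; apply: (@le_lt_trans _ _ ((l - t) * B)).
    by rewrite ler_pM2l ?subr_gt0.
  by rewrite ltr_pM2r.
have [tle0|t0] := leP t 0.
  exists 0.
    exists 0; last exact: linear0.
    by exists 0 => //=; exists 0 => //; rewrite scaler0.
  rewrite subr0 y0E normrZ ger0_norm//.
  apply: le_lt_trans close; rewrite gtr0_norm ?subr_gt0//.
  by apply: ler_wpM2r => //; lra.
have t_neq0 : t != 0 by rewrite gt_eqF.
pose y := t^-1 *: y0.
have y0t : y0 = t *: y by rewrite /y scalerA divff// scale1r.
have [|v Kv vmin] := nearest_image_exists y Ac _ (@closed_closure _ _) Krcv KM.
  by exists 0.
pose z := adjoint A (y - A v).
have zE u : inner z u = inner (A u) (y - A v) by rewrite innerC adjointE.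
have vmax : maximisers Kr z v.
  by split=> // u Ku; rewrite !zE; apply: (nearest_image_variational (C := Kr)).
have tv_near : `|t *: A v - y0| < e.
  apply: le_lt_trans (near_v' close).
  by rewrite y0t -!scalerBr !normrZ ler_wpM2l//; exact: vmin.
have [/contrapT[w mE]|zpol] := hsing (y - A v).
  exists (A (t *: v)); last by rewrite linearZ distrC.
  exists (t *: v) => //; exists t; first exact: ltW.
  exists v => //; apply: hext; apply: (@unique_maximiser_extreme _ _ _ z).
  by move: vmax; rewrite -/Kr -/z in mE *; rewrite mE /= => ->.
have zv0 : 0 <= inner z v.
  by have := vmax.2 _ Kr0; rewrite zE linear0 innerC -{1}(scale0r 0) innerZr mul0r.
have zv' : inner z v' <= 0.
  by apply: zpol; exists 1 => //=; exists v' => //; rewrite scale1r.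
have yAv : y = A v.
  apply/eqP; rewrite -subr_eq0 -normr_eq0 -sqrf_eq0 eq_le sqr_ge0 andbT.
  have yE : y = (t^-1 * l) *: A v' by rewrite /y y0E scalerA.
  rewrite -inner_norm innerDl innerNl {1}yE innerZl -!zE.
  have : 0 <= t^-1 * l by rewrite mulr_ge0// invr_ge0 ltW.
  nra.
have : inf S <= t.
  apply: ge_inf; first exact: hasS.2.
  by split; [exact: ltW|exists v => //; rewrite -yAv].
by rewrite /t; lra.
Qed.
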